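(* For any weight function $\mathbf L:W\to\mathbb N$ there exists a canonical basis $\mathfrak B^{\jmath\imath}_{n,d}=\{\{A\}^{\mathbf L}:A\in\Xi^{\jmath\imath}\}$ of $\mathbb S^{\jmath\imath,\mathbf L}$ such that for all $A\in\Xi^{\jmath\imath}$ $$\overline{\{A\}^{\mathbf L}}=\{A\}^{\mathbf L},\qquad\{A\}^{\mathbf L}\in[A]^{\mathbf L}+\sum_{B\in\Xi^{\jmath\imath},\,B<_{\mathrm{alg}}A}\boldsymbol v^{-c}\,\mathbb Z[\boldsymbol v^{-c}]\,[B]^{\mathbf L},$$ where $c=\gcd(|\mathbf L(s_0)-\mathbf L(s_d)|,\ \mathbf L(s_0)+\mathbf L(s_d),\ \mathbf L(s_1))$. Moreover, $\mathfrak B^{\jmath\imath}_{n,d}=\mathfrak B^{\mathfrak c}_{n,d}\cap\mathbb S^{\jmath\imath,\mathbf L}$, where $\mathfrak B^{\mathfrak c}_{n,d}$ is the canonical basis of $\mathbb S^{\mathfrak c,\mathbf L}_{n,d}$. Here $\Xi^{\jmath\imath}=\{A\in\Xi_{n,d}:\mathrm{row}_{\mathfrak c}(A)_{r+1}=0=\mathrm{col}_{\mathfrak c}(A)_{r+1}\}$ and $\mathbb S^{\jmath\imath}=\mathrm{End}_{\mathbb H}\big(\bigoplus_{\lambda\in\Lambda,\ \lambda_{r+1}=0}x_\lambda\mathbb H\big)\subset\mathbb S^{\mathfrak c}_{n,d}$.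
   Context: **Weyl group.** Fix integers $r\ge 0$, $d\ge 2$; $n=2r+2$, $D=2d+2$, $\mathbb N=\{0,1,\dots\}$. $W$ is the group of permutations $g$ of $\mathbb Z$ with $g(i+D)=g(i)+D$, $g(-i)=-g(i)$ (affine Weyl group of type $\widetilde C_d$). Let $(i,j)_{\mathfrak c}$ swap $kD+i\leftrightarrow kD+j$ and $kD-i\leftrightarrow kD-j$ for all $k$ and fix other integers; Coxeter generators: $s_0=(1,-1)_{\mathfrak c}$, $s_i=(i,i+1)_{\mathfrak c}$ ($1\le i\le d-1$), $s_d=(d,d+2)_{\mathfrak c}$; $\ell$ is the length. $\Lambda$ is the set of $\lambda=(\lambda_0,\dots,\lambda_{r+1})\in\mathbb N^{r+2}$ with sum $d$; $\lambda_{0,i}=\lambda_0+\cdots+\lambda_i$; $W_\lambda$ is generated by $\{s_0,\dots,s_d\}\setminus\{s_{\lambda_0},s_{\lambda_{0,1}},\dots,s_{\lambda_{0,r}}\}$; $\mathscr D_\lambda=\{g:\ell(wg)=\ell(w)+\ell(g)\ \forall w\in W_\lambda\}$; $\mathscr D_{\lambda\mu}=\mathscr D_\lambda\cap\mathscr D_\mu^{-1}$. $R^\lambda_0=[-\lambda_0..\lambda_0]$, $R^\lambda_i=[\lambda_{0,i-1}+1..\lambda_{0,i}]$ ($1\le i\le r$), $R^\lambda_{r+1}=[d+1-\lambda_{r+1}..d+1+\lambda_{r+1}]$, $R^\lambda_{-i}=-R^\lambda_i$, $R^\lambda_{i+n}=R^\lambda_i+D$. **Matrices.** $\Xi_{n,d}$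 is the set of $\mathbb Z\times\mathbb Z$ matrices $A=(a_{ij})$ over $\mathbb N$ with $a_{-i,-j}=a_{ij}=a_{i+n,j+n}$, $a_{00},a_{r+1,r+1}$ odd, $\sum_{i=1}^n\sum_ja_{ij}=D$. $a'_{ii}=\frac12(a_{ii}-1)$ if $i\equiv0,r+1\pmod n$, $a'_{ij}=a_{ij}$ otherwise. $\mathrm{row}_{\mathfrak c}(A)$ has entries (indices $0$; $1\le k\le r$; $r+1$) $a'_{00}+\sum_{j\ge1}a_{0j}$; $\sum_ja_{kj}$; $a'_{r+1,r+1}+\sum_{j\le r}a_{r+1,j}$; $\mathrm{col}_{\mathfrak c}(A)=\mathrm{row}_{\mathfrak c}(A^{\mathrm{transpose}})$. Bijection $\kappa:\bigsqcup_{\lambda,\mu\in\Lambda}\{\lambda\}\times\mathscr D_{\lambda\mu}\times\{\mu\}\to\Xi_{n,d}$, $\kappa(\lambda,g,\mu)=(|R^\lambda_i\cap gR^\mu_j|)$. $A\le_{\mathrm{alg}}B$ iff $\mathrm{row}_{\mathfrak c}(A)=\mathrm{row}_{\mathfrak c}(B)$, $\mathrm{col}_{\mathfrak c}(A)=\mathrm{col}_{\mathfrak c}(B)$ and $\sum_{x\le i,y\ge j}a_{xy}\le\sum_{x\le i,y\ge j}b_{xy}$ for all $i<j$; $<_{\mathrm{alg}}$ is the strict version. **Hecke and Schur algebras.** $\mathbb A=\mathbb Z[q^{\pm1/2},q_0^{\pm1/2},q_1^{\pm1/2}]$; $\mathbb H$ is the $\mathbb A$-algebra generated by $T_0,\dots,T_d$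 with the braid relations of $W$ and $(T_0-q_0^{-1})(T_0+q_1)=0$, $(T_i-q^{-1})(T_i+q)=0$ ($1\le i\le d-1$), $(T_d-q_1^{-1})(T_d+q_0^{-1})=0$. $T_w$, $q_w$ are multiplicative along reduced words, $q_{s_0}=q_1$, $q_{s_i}=q$ ($1\le i\le d-1$), $q_{s_d}=q_0^{-1}$. $T_X=\sum_{w\in X}q_w^{-1}T_w$, $x_\lambda=T_{W_\lambda}$. $\mathbb S^{\mathfrak c}_{n,d}=\mathrm{End}_{\mathbb H}(\bigoplus_{\lambda\in\Lambda}x_\lambda\mathbb H)$ has $\mathbb A$-basis $e_A$ ($A=\kappa(\lambda,g,\mu)$), $e_A(x_\nu)=\delta_{\mu\nu}T_{W_\lambda gW_\mu}$. Standard basis: $[A]=q_0^{\frac12(\hat\ell_{\mathfrak c_0}(A)-\hat\ell_{\mathfrak c_d}(A))}q_1^{\frac12(\hat\ell_{\mathfrak c_0}(A)+\hat\ell_{\mathfrak c_d}(A))}q^{\hat\ell_{\mathfrak a}(A)}e_A$, where $\hat\ell_{\mathfrak c_0}(A)=\frac12(\sum_{x\le0,y>0}+\sum_{x\ge0,y<0})a_{xy}$, $\hat\ell_{\mathfrak c_d}(A)=\frac12(\sum_{x\le r+1,y>r+1}+\sum_{x\ge r+1,y<r+1})a_{xy}$, $\hat\ell_{\mathfrak a}(A)=\frac12\sum_{(i,j)\in I^+}(\sum_{x\le i,y>j}+\sum_{x\ge i,y<j})a''_{ij}a_{xy}$, $I^+=(\{0\}\times\mathbb N)\sqcup([1..r]\times\mathbb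 Z)\sqcup(\{r+1\}\times\mathbb Z_{\le r+1})$, $a''_{ii}=\frac12(a_{ii}-3)$ for $i=0,r+1$, $a''_{ij}=a_{ij}$ otherwise. $\mathbb S^{\jmath\imath}$ is naturally a (non-unital) subalgebra with basis $\{[A]:A\in\Xi^{\jmath\imath}\}$. **Bar involution.** On $\mathbb H$: inverts $q^{1/2},q_0^{1/2},q_1^{1/2}$, $\overline{T_w}=T_{w^{-1}}^{-1}$. On $\mathbb S^{\mathfrak c}_{n,d}$: $\overline f(x_\mu)=\overline{f(\overline{x_\mu})}$ for $f\in\mathrm{Hom}_{\mathbb H}(x_\mu\mathbb H,x_\lambda\mathbb H)$. **Specialization.** A weight function $\mathbf L:W\to\mathbb N$ satisfies $\mathbf L(ww')=\mathbf L(w)+\mathbf L(w')$ whenever $\ell(ww')=\ell(w)+\ell(w')$. A superscript $\mathbf L$ denotes base change to $\mathbb Z[\boldsymbol v^{\pm1/2}]$ along $q\mapsto\boldsymbol v^{-\mathbf L(s_1)}$, $q_0\mapsto\boldsymbol v^{-\mathbf L(s_0)+\mathbf L(s_d)}$, $q_1\mapsto\boldsymbol v^{-\mathbf L(s_0)-\mathbf L(s_d)}$ (and square roots), with bar $\boldsymbol v^{1/2}\mapsto\boldsymbol v^{-1/2}$. The canonical basis $\mathfrak B^{\mathfrak c}_{n,d}=\{\{A\}^{\mathbf L}:A\in\Xi_{n,d}\}$ of $\mathbb S^{\mathfrak c,\mathbf L}_{n,d}$ is characterized by consisting of bar-invariant elements with $\{A\}^{\mathbf L}\in[A]^{\mathbf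 L}+\sum_{B\in\Xi_{n,d},\,B<_{\mathrm{alg}}A}\boldsymbol v^{-c}\mathbb Z[\boldsymbol v^{-c}][B]^{\mathbf L}$, with the same $c$.
   Formalization: For some L, e.g. r=d=2, L(s_0)=L(s_d)=1, L(s_1)=2, where c=2, no such canonical bases exist; so the theorem assumes that the canonical basis of S^{c,L}, as characterized with this c, exists and is given, and derives that of S^{ji,L} and the intersection identity from it. *)

(* Defs.v *)
From HB Require Import structures.
From mathcomp Require Import all_boot all_order all_algebra.
From mathcomp Require Import finmap all_classical.
From mathcomp Require Import zify ring.

Set Implicit Arguments.
Unset Strict Implicit.
Unset Printing Implicit Defensive.

Import Order.TTheory GRing.Theory Num.Theory.
Local Open Scope classical_set_scope.
Local Open Scope ring_scope.


(** The group ring Z[K] of an abelian group, as finitely supported functions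
    with the convolution product. *)
Section GroupRing.
Variable K : zmodType.
Implicit Types (f g h : K -> int) (k e : K).

Definition fsupp : {pred K -> int} :=
  fun f => `[< finite_set [set k | f k != 0] >].

Lemma fsupp_zmod_closed : zmod_closed fsupp.
Proof.
split.
  apply/asboolP; rewrite (_ : [set _ | _] = set0) ?eqEsubset //.
  by split=> // k /=; rewrite eqxx.
move=> f g /asboolP hf /asboolP hg; apply/asboolP.
apply: (@sub_finite_set _ _ ([set k | f k != 0] `|` [set k | g k != 0])).
  move=> k /= hk; have [f0|] := eqVneq (f k) 0; last by left.
  by right; apply: contraNneq hk => g0; rewrite !fctE f0 g0 subr0.
by rewrite finite_setU.
Qed.
HB.instance Definition _ :=
  GRing.isZmodClosed.Build (K -> int) fsupp fsupp_zmod_closed.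

Record gring := GRingElt { coefg :> K -> int; _ : coefg \in fsupp }.
HB.instance Definition _ := [isSub for coefg].
HB.instance Definition _ := [Choice of gring by <:].
HB.instance Definition _ := [SubChoice_isSubZmodule of gring by <:].

Lemma gring_fin (a : gring) : finite_set [set k | a k != 0].
Proof. by case: a => f /= /asboolP. Qed.

Lemma gring_eq (a b : gring) : (forall k, a k = b k) -> a = b.
Proof. by move=> h; apply: val_inj; apply/funext. Qed.

Definition conv f g : K -> int := fun k => \sum_(e \in setT) f e * g (k - e).

Lemma fsum_widen (I : choiceType) (F : I -> int) (A : set I) :
  (forall i, F i != 0 -> A i) ->
  \sum_(i \in setT) F i = \sum_(i \in A) F i.
Proof.
move=> sA; apply/esym/fsbig_widen => // i [_ nA] /=.
by apply/eqP; apply: contrapT => /negP/sA.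
Qed.

Lemma mulr_neq0l (x y : int) : x * y != 0 -> x != 0.
Proof. by apply: contraNneq => ->; rewrite mul0r. Qed.

Lemma mulr_neq0r (x y : int) : x * y != 0 -> y != 0.
Proof. by apply: contraNneq => ->; rewrite mulr0. Qed.

Lemma convE f g (A : set K) k : [set e | f e != 0] `<=` A ->
  conv f g k = \sum_(e \in A) f e * g (k - e).
Proof. by move=> sA; apply: fsum_widen => e /mulr_neq0l /sA. Qed.

Lemma conv_fsupp (a b : gring) : conv a b \in fsupp.
Proof.
apply/asboolP.
apply: (@sub_finite_set _ _
  ((fun p => p.1 + p.2) @` ([set k | a k != 0] `*` [set k | b k != 0]))).
  move=> k /= hk; apply: contrapT => hn; case/negP: hk; apply/eqP.
  rewrite /conv fsbig1 // => e _; apply/eqP; apply: contrapT => /negP h.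
  apply: hn; exists (e, k - e); last by rewrite /= subrKC.
  by split; [exact: mulr_neq0l h | exact: mulr_neq0r h].
by apply: finite_image; apply: finite_setX; exact: gring_fin.
Qed.

Definition monoe_fun e : K -> int := fun k => (k == e)%:R.

Lemma monoe_fsupp e : monoe_fun e \in fsupp.
Proof.
apply/asboolP; apply: (@sub_finite_set _ _ [set e]); last exact: finite_set1.
by move=> k /=; rewrite /monoe_fun; have [->|] := eqVneq k e; rewrite ?eqxx.
Qed.

Definition mono e : gring := GRingElt (monoe_fsupp e).
Definition gmul (a b : gring) : gring := GRingElt (conv_fsupp a b).

Lemma gmulC : commutative gmul.
Proof.
move=> a b; apply: gring_eq => k /=; rewrite /conv.
rewrite (reindex_fsbigT (fun e => k - e)) /=; last first.
  by exists (fun e => k - e) => e; rewrite subKr.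
by apply: eq_fsbigr => e _; rewrite subKr mulrC.
Qed.

Lemma gmul1 : left_id (mono 0) gmul.
Proof.
move=> b; apply: gring_eq => k /=; rewrite (@convE _ _ [set 0]) => [|e /=].
  by rewrite fsbig_set1 /= /monoe_fun eqxx mul1r subr0.
by rewrite /monoe_fun; have [->|] := eqVneq e 0; rewrite ?eqxx.
Qed.

Lemma gmulDl : left_distributive gmul +%R.
Proof.
move=> a b c; apply: gring_eq => k.
have -> : (gmul a c + gmul b c : gring) k = conv a c k + conv b c k by [].
pose A := [set e | a e != 0] `|` [set e | b e != 0].
have fA : finite_set A by rewrite finite_setU; split; exact: gring_fin.
rewrite /= (@convE a _ A) ?(@convE b _ A); [|by right|by left].
rewrite -fsbig_split //= (@convE (a \+ b) _ A).
  by apply: eq_fsbigr => e _; rewrite -mulrDl.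
move=> e /=; rewrite /A /=.
have [h|] := eqVneq (a e) 0; last by left.
by move=> h'; right; apply: contraNneq h' => h'; rewrite h h' addr0.
Qed.

Lemma fsumZ (A : set K) (F : K -> int) c : finite_set A ->
  \sum_(e \in A) c * F e = c * \sum_(e \in A) F e.
Proof. by move=> fA; rewrite !fsbig_finite //= mulr_sumr. Qed.

Lemma gmulA : associative gmul.
Proof.
move=> a b c; apply: gring_eq => k /=.
pose A := [set e | a e != 0]; pose B := [set e | b e != 0].
pose C := (fun p => p.1 + p.2) @` (A `*` B).
have fA : finite_set A by exact: gring_fin.
have fB : finite_set B by exact: gring_fin.
have fC : finite_set C by apply: finite_image; exact: finite_setX.
have sC : [set e | gmul a b e != 0] `<=` C.
  move=> l /= hk; apply: contrapT => hn; case/negP: hk; apply/eqP.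
  rewrite /conv fsbig1 // => e _; apply/eqP; apply: contrapT => /negP h.
  apply: hn; exists (e, l - e); last by rewrite /= subrKC.
  by split; [exact: mulr_neq0l h | exact: mulr_neq0r h].
rewrite (@convE a _ A) // (@convE (gmul a b) _ C) //.
transitivity (\sum_(x \in A) \sum_(e \in C) (a x * b (e - x)) * c (k - e)).
  apply: eq_fsbigr => x; rewrite inE => xA.
  have xB : bijective (fun e => e - x).
    by apply: (Bijective (g := fun e => e + x)) => e; rewrite ?addrK ?subrK.
  rewrite /= /conv (reindex_fsbigT _ _ xB) /=.
  rewrite (@fsum_widen _ _ C) => [|e /mulr_neq0l h]; last first.
    by exists (x, e - x); rewrite //= subrKC.
  rewrite -fsumZ //; apply: eq_fsbigr => e _.
  by rewrite mulrA; congr (_ * c _); rewrite opprB addrA subrK.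
rewrite exchange_fsbig //; apply: eq_fsbigr => e _ /=.
rewrite (@convE a _ A) // mulrC -fsumZ //.
by apply: eq_fsbigr => x _; rewrite mulrC.
Qed.

Lemma gring1_neq0 : mono 0 != 0.
Proof.
apply/negP => /eqP /(congr1 (fun a : gring => a 0)) /=.
by rewrite /monoe_fun eqxx.
Qed.

HB.instance Definition _ := GRing.Zmodule_isComNzRing.Build gring
  gmulA gmulC gmul1 gmulDl gring1_neq0.

End GroupRing.

(** Z-linear extension of [mono e |-> mono (phi e)]; a ring morphism when [phi]
    is a group morphism. *)
Definition push (K K' : zmodType) (phi : K -> K') (a : gring K) : gring K' :=
  \sum_(e \in [set: K]) mono (phi e) *~ a e.

(** Z[q^{+-1/2}, q_0^{+-1/2}, q_1^{+-1/2}]: [monA (a, b, c)] is the monomial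
    q^{a/2} q_0^{b/2} q_1^{c/2}. *)
Definition expA : zmodType := (int * int * int)%type.
Definition AA := gring expA.
Definition monA (e : expA) : AA := mono e.

(** Z[v^{+-1/2}]: [monR k] is v^{k/2}. *)
Definition expR : zmodType := int.
Definition RR := gring expR.
Definition monR (k : expR) : RR := mono k.

Definition barA : AA -> AA := @push expA expA (fun e => - e).
Definition barR : RR -> RR := @push expR expR (fun k => - k).

HB.instance Definition _ := GRing.ComNzRing.on AA.
HB.instance Definition _ := GRing.ComNzRing.on RR.


Section Weyl.
Variable d : nat.

Definition Dper : int := (d.*2 + 2)%N%:Z.

Definition affC (g : int -> int) : Prop :=
  [/\ bijective g, forall i, g (i + Dper) = g i + Dper
    & forall i, g (- i) = - g i].

Record weyl := Weyl { wact :> int -> int; _ : `[< affC wact >] }.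
HB.instance Definition _ := [isSub for wact].
HB.instance Definition _ := [Choice of weyl by <:].

Lemma weylP (g : weyl) : affC g.
Proof. by case: g => g /= /asboolP. Qed.

Lemma affC_id : `[< affC id >].
Proof. by apply/asboolP; split=> //; exists id. Qed.

Lemma affC_comp (g h : weyl) : `[< affC (g \o h) >].
Proof.
have [bg sg og] := weylP g; have [bh sh oh] := weylP h; apply/asboolP.
by split=> [|i|i] /=; [exact: bij_comp | rewrite sh sg | rewrite oh og].
Qed.

Lemma affC_inv (g : weyl) : exists h : weyl, cancel g h /\ cancel h g.
Proof.
have [[h gK hK] sg og] := weylP g.
have ah : `[< affC h >].
  apply/asboolP; split=> [|i|i]; first by exists g.
    by apply: (can_inj gK); rewrite hK sg hK.
  by apply: (can_inj gK); rewrite hK og hK.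
by exists (Weyl ah).
Qed.

Definition weyl1 := Weyl affC_id.
Definition weylM (g h : weyl) := Weyl (affC_comp g h).
Definition weylV (g : weyl) := sval (cid (affC_inv g)).

Lemma weylMA : associative weylM.
Proof. by move=> g h k; apply: val_inj. Qed.
Lemma weyl1M : left_id weyl1 weylM.
Proof. by move=> g; apply: val_inj. Qed.
Lemma weylM1 : right_id weyl1 weylM.
Proof. by move=> g; apply: val_inj. Qed.
Lemma weylVM : left_inverse weyl1 weylV weylM.
Proof.
move=> g; apply: val_inj; apply/funext => i /=.
by rewrite /weylV; case: cid => h /= [].
Qed.
Lemma weylMV : right_inverse weyl1 weylV weylM.
Proof.
move=> g; apply: val_inj; apply/funext => i /=.
by rewrite /weylV; case: cid => h /= [].
Qed.

HB.instance Definition _ :=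
  isGroup.Build weyl weylMA weyl1M weylM1 weylVM weylMV.

Definition ctransp (i j x : int) : int :=
  if (Dper %| x - i)%Z then x - i + j
  else if (Dper %| x - j)%Z then x - j + i
  else if (Dper %| x + i)%Z then x + i - j
  else if (Dper %| x + j)%Z then x + j - i
  else x.

Definition sfun (i : 'I_d.+1) : int -> int :=
  if val i == 0%N then ctransp 1 (- 1)
  else if val i == d then ctransp d%:Z (d%:Z + 2)
  else ctransp (val i)%:Z ((val i)%:Z + 1).

(** The default value of [insubd] is never used for [d >= 2]; see [sgenE]. *)
Definition sgen (i : 'I_d.+1) : weyl := insubd (1%g : weyl) (sfun i).

End Weyl.
Section CoxeterGenerators.
Variables (d : nat) (i j : int).
Let D := Dper d.

Ltac dvd_contra dv dD dB dN :=
  exfalso;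
  match goal with
  | h : is_true (_ %| _)%Z, n : is_true (~~ (_ %| _)%Z) |- _ =>
     case/negP: n; first [apply: dv h _; ring | apply: dv (dN _ h) _; ring]
  | h : is_true (_ %| _)%Z, h' : is_true (_ %| _)%Z,
    n : is_true (~~ (_ %| _)%Z) |- _ =>
     case/negP: n; first [apply: dv (dD _ _ h h') _; ring
       | apply: dv (dB _ _ h h') _; ring | apply: dv (dB _ _ h' h) _; ring
       | apply: dv (dN _ (dD _ _ h h')) _; ring]
  end.

Ltac dvd_cases :=
  repeat match goal with
  | |- context [if ?b then _ else _] =>
      lazymatch b with context [if _ then _ else _] => fail | _ => idtac end;
      let h := fresh "h" in case: (boolP b) => h /=
  end.

Lemma ctransp_affC : ~~ (D %| i - j)%Z -> ~~ (D %| i + i)%Z ->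
  ~~ (D %| j + j)%Z -> affC d (ctransp d i j).
Proof.
move=> nij ni nj.
have dv x y : (D %| x)%Z -> x = y -> (D %| y)%Z by move=> h <-.
have dB x y : (D %| x)%Z -> (D %| y)%Z -> (D %| x - y)%Z by exact: rpredB.
have dD x y : (D %| x)%Z -> (D %| y)%Z -> (D %| x + y)%Z by exact: rpredD.
have dN x : (D %| x)%Z -> (D %| - x)%Z by exact: rpredNr.
have shift x e : (D %| x + D + e)%Z = (D %| x + e)%Z.
  by rewrite addrAC rpredDr // dvdzz.
have inv : involutive (ctransp d i j).
  move=> x; rewrite /ctransp -/D; dvd_cases; try ring; dvd_contra dv dD dB dN.
split=> [|x|x].
- exact: inv_bij.
- by rewrite /ctransp -/D !shift; dvd_cases; ring.
- by rewrite /ctransp -/D; dvd_cases; try ring; dvd_contra dv dD dB dN.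
Qed.

End CoxeterGenerators.

Lemma sgenE d (i : 'I_d.+1) : (1 < d)%N -> sgen i = sfun i :> (int -> int).
Proof.
move=> hd; rewrite /sgen insubdK //; apply/asboolP.
have ndv (k : int) : (0 < `|k| < d.*2 + 2)%N -> ~~ (Dper d %| k)%Z.
  move=> /andP[k0 kD]; rewrite dvdzE /=; apply/negP => /(dvdn_leq k0); lia.
rewrite /sfun; case: i => i hi /=.
case: eqP => i0; [|case: eqP => id]; apply: ctransp_affC;
  try by apply: ndv; lia.
rewrite (_ : _ + _ = 2 + Dper d); last by rewrite /Dper; lia.
by rewrite rpredDr ?dvdzz //; apply: ndv; lia.
Qed.

Section Length.
Variable d : nat.
Implicit Types (w g : weyl d).

Definition wprod (s : seq 'I_d.+1) : weyl d := (\prod_(i <- s) sgen i)%g.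

Definition reduced_word w : seq 'I_d.+1 :=
  xget [::] [set s | wprod s = w /\
                     forall s', wprod s' = w -> (size s <= size s')%N].

Definition len w : nat := size (reduced_word w).

Definition weight_function (L : weyl d -> nat) : Prop :=
  forall w w', len (w * w')%g = (len w + len w')%N ->
    L (w * w')%g = (L w + L w')%N.

(** Exponent of q_{s_i}: q_1 for i = 0, q for 0 < i < d, q_0^{-1} for i = d. *)
Definition qexp_gen (i : 'I_d.+1) : expA :=
  if val i == 0%N then (0, 0, 2) else if val i == d then (0, - 2, 0)
  else (2, 0, 0).

Definition qexp w : expA :=
  \sum_(i <- reduced_word w) qexp_gen i.

End Length.


Section Parabolic.
Variables r d : nat.

Definition nper : int := (r.*2 + 2)%N%:Z.

Definition is_compo (l : {ffun 'I_r.+2 -> 'I_d.+1}) : bool :=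
  (\sum_i l i)%N == d.

(** The parts are bounded by their sum [d], whence the codomain ['I_d.+1]. *)
Record compo := Compo { parts :> {ffun 'I_r.+2 -> 'I_d.+1};
                        _ : is_compo parts }.
HB.instance Definition _ := [isSub for parts].
HB.instance Definition _ := [Finite of compo by <:].

Implicit Types l m : compo.

Definition part l (k : nat) : nat := l (inord k).
Definition psum l (k : nat) : nat := (\sum_(j < k.+1) part l j)%N.

Definition par_gen l (i : 'I_d.+1) : bool :=
  [forall k : 'I_r.+1, val i != psum l k].

(** The generators are involutions, so that products of generators exhaust
    the subgroup they generate. *)
Definition parabolic l : set (weyl d) :=
  [set w | exists2 s, all (par_gen l) s & w = wprod s].

Definition min_left l : set (weyl d) :=
  [set g | forall w, parabolic l w -> len (w * g)%g = (len w + len g)%N].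

Definition min_double l m : set (weyl d) :=
  [set g | min_left l g /\ min_left m (g^-1)%g].

Definition double_coset l (g : weyl d) m : set (weyl d) :=
  [set w | exists u v, [/\ parabolic l u, parabolic m v & w = (u * g * v)%g]].

Definition block0 l (k : nat) : set int :=
  if k == 0%N then [set x | - (part l 0)%:Z <= x <= (part l 0)%:Z]
  else if (k <= r)%N then
    [set x | (psum l k.-1)%:Z + 1 <= x <= (psum l k)%:Z]
  else [set x | d%:Z + 1 - (part l r.+1)%:Z <= x
                <= d%:Z + 1 + (part l r.+1)%:Z].

(** The index is reduced modulo [nper] to [0, nper - 1]; residues above [r+1]
    are the translates by [nper] of the indices [- r, ..., - 1]. *)
Definition block l (i : int) : set int :=
  let k := `|(i %% nper)%Z|%N in let t := (i %/ nper)%Z * Dper d in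
  if (k <= r.+1)%N then [set x | block0 l k (x - t)]
  else [set x | block0 l (r.*2 + 2 - k) (- (x - t - Dper d))].

Definition kappa l (g : weyl d) m : int -> int -> nat :=
  fun i j => #|` fset_set (block l i `&` (g @` block m j))|.

End Parabolic.


Section Matrices.
Variables r d : nat.
Implicit Types a b : int -> int -> nat.

Definition r1 : int := r.+1%:Z.

(** Sums over infinite index sets; all of them are finitely supported for the
    matrices of [Xi]. *)
Definition nsum (I : choiceType) (P : set I) (F : I -> nat) : nat :=
  \big[addn/0%N]_(i \in P) F i.

Definition is_Xi a : Prop :=
  [/\ forall i j, a (- i) (- j) = a i j /\ a i j = a (i + nper r) (j + nper r),
      odd (a 0 0) /\ odd (a r1 r1),
      forall i, finite_set [set j : int | a i j != 0%N]
    & (\sum_(1 <= i < r.*2 + 3) nsum setT (a i%:Z))%N = d.*2.+2].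

Record Xi := XiElt { entry :> int -> int -> nat; _ : `[< is_Xi entry >] }.
HB.instance Definition _ := [isSub for entry].
HB.instance Definition _ := [Choice of Xi by <:].

Definition rowc a (k : 'I_r.+2) : nat :=
  if val k == 0%N then ((a 0 0).-1./2 + nsum [set j : int | (1 <= j)%R] (a 0))%N
  else if val k == r.+1 then
    ((a r1 r1).-1./2 + nsum [set j : int | (j <= r%:Z)%R] (a r1))%N
  else nsum setT (a (val k)%:Z).

Definition colc a : 'I_r.+2 -> nat := rowc (fun i j => a j i).

Definition alg_le a b : Prop :=
  [/\ rowc a =1 rowc b, colc a =1 colc b
    & forall i j, i < j ->
        (nsum [set p : int * int | (p.1 <= i)%R /\ (j <= p.2)%R] (fun p => a p.1 p.2)
         <= nsum [set p : int * int | (p.1 <= i)%R /\ (j <= p.2)%R] (fun p => b p.1 p.2))%N].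

Definition alg_lt (A B : Xi) : Prop := alg_le A B /\ A <> B.

Definition Xiji : set Xi :=
  [set A | rowc A ord_max = 0%N /\ colc A ord_max = 0%N].

(** Sum of the entries strictly north-east, resp. south-west, of (i, j). *)
Definition ne_sum a (i j : int) : nat :=
  nsum [set p : int * int | p.1 <= i /\ j < p.2] (fun p => a p.1 p.2).
Definition sw_sum a (i j : int) : nat :=
  nsum [set p : int * int | i <= p.1 /\ p.2 < j] (fun p => a p.1 p.2).

(** The two sums are equal, so halving is exact. *)
Definition ell_c0 a : int := ((ne_sum a 0 0 + sw_sum a 0 0)./2)%:Z.
Definition ell_cd a : int := ((ne_sum a r1 r1 + sw_sum a r1 r1)./2)%:Z.

(** Possibly negative; the division is exact since the entry is odd. *)
Definition entry2 a (i j : int) : int :=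
  if (i == j) && ((i == 0) || (i == r1)) then (((a i i)%:Z - 3) %/ 2)%Z
  else (a i j)%:Z.

Definition Iplus : set (int * int) :=
  [set p : int * int | [\/ p.1 = 0 /\ 0 <= p.2, 1 <= p.1 <= r%:Z
             | p.1 = r1 /\ p.2 <= r1]].

(** Twice the statistic, i.e. the exponent of q^{1/2}. *)
Definition ell_a2 a : int :=
  \sum_(p \in Iplus)
    entry2 a p.1 p.2 * (ne_sum a p.1 p.2 + sw_sum a p.1 p.2)%N%:Z.

(** [A] = [monA (std_exp A)] e_A. *)
Definition std_exp a : expA :=
  (ell_a2 a, ell_c0 a - ell_cd a, ell_c0 a + ell_cd a).

End Matrices.


Section Hecke.
Variables (d : nat).
Notation q := (monA (2, 0, 0)).
Notation qV := (monA (- 2, 0, 0)).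
Notation q0V := (monA (0, - 2, 0)).
Notation q1 := (monA (0, 0, 2)).
Notation q1V := (monA (0, 0, - 2)).

(** Defining relations; the braid relations are those of the Coxeter diagram
    of type C~_d: order 4 for {s_0, s_1} and {s_{d-1}, s_d}, order 3 for
    {s_i, s_{i+1}} with 0 < i < d - 1, order 2 otherwise. *)
Definition hecke_relations (B : algType AA) (t : 'I_d.+1 -> B) : Prop :=
  let T k := t (inord k) in
  [/\ (T 0%N - q0V%:A) * (T 0%N + q1%:A) = 0
      /\ (forall i, (0 < i < d)%N -> (T i - qV%:A) * (T i + q%:A) = 0)
      /\ (T d - q1V%:A) * (T d + q0V%:A) = 0,
      T 0%N * T 1%N * T 0%N * T 1%N = T 1%N * T 0%N * T 1%N * T 0%N,
      T d.-1 * T d * T d.-1 * T d = T d * T d.-1 * T d * T d.-1,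
      forall i, (0 < i)%N -> (i.+1 < d)%N ->
        T i * T i.+1 * T i = T i.+1 * T i * T i.+1
    & forall i j, (i.+1 < j <= d)%N -> T i * T j = T j * T i].

Definition alg_morphism (B C : algType AA) (f : B -> C) : Prop :=
  linear f /\ monoid_morphism f.

(** Presentation of an algebra, by its universal property. *)
Definition hecke_algebra (H : algType AA) (T : 'I_d.+1 -> H) : Prop :=
  hecke_relations T /\
  forall (B : algType AA) (t : 'I_d.+1 -> B), hecke_relations t ->
    exists! f : H -> B, alg_morphism f /\ forall i, f (T i) = t i.

Variables (H : algType AA) (T : 'I_d.+1 -> H).

Definition Tw (w : weyl d) : H := \prod_(i <- reduced_word w) T i.

Definition Tset (X : set (weyl d)) : H :=
  \sum_(w \in X) (monA (- qexp w)) *: Tw w.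

Definition is_barH (b : H -> H) : Prop :=
  [/\ forall h h', b (h + h') = b h + b h', monoid_morphism b,
      forall a h, b (a *: h) = barA a *: b h
    & forall w, b (Tw w) * Tw (w^-1)%g = 1 /\ Tw (w^-1)%g * b (Tw w) = 1].

Definition barH : H -> H := xget (fun=> 0 : H) is_barH.

End Hecke.


Section Schur.
Variables (r d : nat) (H : algType AA) (T : 'I_d.+1 -> H).
Local Notation compo := (compo r d).

Definition xpar (l : compo) : H := Tset T (parabolic l).

(** The right H-module (+)_l x_l H, inside H^compo. *)
Definition in_perm_module : {pred {ffun compo -> H}} :=
  fun u => `[< forall l, exists h, u l = xpar l * h >].

Lemma in_perm_module_closed : submod_closed in_perm_module.
Proof.
split=> [|a u v /asboolP hu /asboolP hv]; apply/asboolP => l.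
  by exists 0; rewrite ffunE mulr0.
have [h hE] := hu l; have [k kE] := hv l; exists (a *: h + k).
by rewrite !ffunE hE kE mulrDr scalerAr.
Qed.
HB.instance Definition _ :=
  GRing.isSubmodClosed.Build AA {ffun compo -> H} in_perm_module
    in_perm_module_closed.

Record perm_module := PermModule {
  comps :> {ffun compo -> H}; _ : comps \in in_perm_module }.
HB.instance Definition _ := [isSub for comps].
HB.instance Definition _ := [Choice of perm_module by <:].
HB.instance Definition _ := [SubChoice_isSubLmodule of perm_module by <:].

Lemma perm_moduleP (u : perm_module) l : exists h, u l = xpar l * h.
Proof. by case: u => u /= /asboolP. Qed.

Lemma ract_subproof (u : perm_module) (h : H) :
  [ffun l => u l * h] \in in_perm_module.
Proof.
apply/asboolP => l; have [k kE] := perm_moduleP u l.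
by exists (k * h); rewrite ffunE kE mulrA.
Qed.

Definition ract (u : perm_module) (h : H) : perm_module :=
  PermModule (ract_subproof u h).

Definition single (l : compo) (h : H) : {ffun compo -> H} :=
  [ffun m => if m == l then h else 0].

Lemma pgen_subproof l : single l (xpar l) \in in_perm_module.
Proof.
apply/asboolP => m; rewrite ffunE; case: eqP => [->|_].
  by exists 1; rewrite mulr1.
by exists 0; rewrite mulr0.
Qed.

Definition pgen l : perm_module := PermModule (pgen_subproof l).

Definition is_endo : {pred perm_module -> perm_module} :=
  fun f => `[< (forall u v, f (u + v) = f u + f v) /\
               (forall u h, f (ract u h) = ract (f u) h) >].

Lemma ract_linear (h : H) a u v : ract (a *: u + v) h = a *: ract u h + ract v h.
Proof.
by apply: val_inj; apply/ffunP => l; rewrite /= !ffunE mulrDl scalerAl.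
Qed.

Lemma is_endo_closed : submod_closed is_endo.
Proof.
split=> [|a f g /asboolP[fD fR] /asboolP[gD gR]]; apply/asboolP; split.
- by move=> u v /=; rewrite addr0.
- by move=> u h; apply: val_inj; apply/ffunP => l; rewrite /= !ffunE mul0r.
- by move=> u v; rewrite !fctE /= fD gD scalerDr addrACA.
- by move=> u h; rewrite !fctE /= fR gR ract_linear.
Qed.
HB.instance Definition _ :=
  GRing.isSubmodClosed.Build AA (perm_module -> perm_module) is_endo
    is_endo_closed.

Record schur := Schur {
  endo :> perm_module -> perm_module; _ : endo \in is_endo }.
HB.instance Definition _ := [isSub for endo].
HB.instance Definition _ := [Choice of schur by <:].
HB.instance Definition _ := [SubChoice_isSubLmodule of schur by <:].

Definition ebasis (A : Xi r d) : schur :=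
  xget 0 [set f : schur | exists l g m,
    [/\ min_double l m g, kappa l g m = A
      & forall n, comps (f (pgen n)) =
          single l (if n == m then Tset T (double_coset l g m) else 0)]].

(** The standard basis element [A]. *)
Definition sbasis (A : Xi r d) : schur :=
  (monA (std_exp r A)) *: ebasis A.

(** The endomorphisms vanishing on x_m H for m_{r+1} <> 0 and with values in
    the sum of the x_l H with l_{r+1} = 0, i.e. End_H of that sum, extended by
    zero. *)
Definition schur_ji : set schur :=
  [set f : schur |
     (forall m : compo, part m r.+1 != 0%N -> f (pgen m) = 0) /\
     (forall u (l : compo), part l r.+1 != 0%N -> f u l = 0)].

(** The element g with g(x_m) = bar (f (bar x_m)) for all m. *)
Definition barS (f : schur) : schur :=
  xget 0 [set g : schur | forall m, exists u : perm_module,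
    comps u = single m (barH T (xpar m)) /\
    forall l, g (pgen m) l = barH T (f u l)].

End Schur.


Definition semilinear (A B : nzRingType) (s : A -> B) (V : lmodType A)
    (W : lmodType B) (f : V -> W) : Prop :=
  forall a u v, f (a *: u + v) = s a *: f u + f v.

(** Extension of scalars along [s], by the universal property of the tensor
    product. *)
Definition base_change (A B : nzRingType) (s : A -> B) (V : lmodType A)
    (W : lmodType B) (iota : V -> W) : Prop :=
  semilinear s iota /\
  forall (U : lmodType B) (f : V -> U), semilinear s f ->
    exists! g : W -> U, linear g /\ forall v, g (iota v) = f v.

Section Specialization.
Variables (r d : nat) (L : weyl d -> nat).

Let L0 : int := (L (sgen (inord 0)))%:Z.
Let L1 : int := (L (sgen (inord 1)))%:Z.
Let Ld : int := (L (sgen (inord d)))%:Z.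

(** q^{1/2}, q_0^{1/2}, q_1^{1/2} go to v^{- L1 / 2}, v^{(- L0 + Ld) / 2},
    v^{(- L0 - Ld) / 2}. *)
Definition spec : AA -> RR :=
  @push expA expR
    (fun e => e.1.1 * (- L1) + e.1.2 * (- L0 + Ld) + e.2 * (- L0 - Ld)).

Definition cgcd : nat := gcdn (gcdn `|L0 - Ld| `|L0 + Ld|) `|L1|.

Definition vVc : RR := monR (- (cgcd.*2)%:Z).

Definition vVcZ : set RR :=
  [set z | exists p : {poly int}, z = vVc * (map_poly intr p).[vVc]].

Variables (H : algType AA) (T : 'I_d.+1 -> H).
Variables (SL : lmodType RR) (iota : schur r T -> SL).

Definition sbasisL (A : Xi r d) : SL := iota (sbasis T A).

(** The submodule generated by the image of [schur_ji]; [schur_ji] being a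
    direct summand of [schur], this is its base change. *)
Definition schurL_ji : set SL :=
  [set u | exists s : seq (RR * schur r T),
     (forall p, p \in s -> schur_ji p.2) /\ u = \sum_(p <- s) p.1 *: iota p.2].

Definition is_barL (b : SL -> SL) : Prop :=
  semilinear barR b /\ forall f, b (iota f) = iota (barS f).

Definition barL : SL -> SL := xget (fun=> 0 : SL) is_barL.

Definition is_basis (D : set (Xi r d)) (V : set SL) (b : Xi r d -> SL) : Prop :=
  (forall A, D A -> V (b A)) /\
  forall u, V u -> exists! c : Xi r d -> RR,
    [/\ finite_set [set A | c A != 0], forall A, c A != 0 -> D A
      & u = \sum_(A \in D) c A *: b A].

(** [b A], for A in [D], is the canonical basis of [V]; the values of [b]
    outside [D] are irrelevant. *)
Definition canonical_basis (D : set (Xi r d)) (V : set SL)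
    (b : Xi r d -> SL) : Prop :=
  is_basis D V b /\
  forall A, D A ->
    barL (b A) = b A /\
    exists c : Xi r d -> RR,
      [/\ finite_set [set B | c B != 0], forall B, vVcZ (c B)
        & b A = sbasisL A +
            \sum_(B \in [set B | D B /\ alg_lt B A]) c B *: sbasisL B].

End Specialization.

(* Main.v *)
From HB Require Import structures.
Require Import Defs.
From mathcomp Require Import all_boot all_order all_algebra.
From mathcomp Require Import finmap all_classical.
From mathcomp Require Import zify ring.

Set Implicit Arguments.
Unset Strict Implicit.
Unset Printing Implicit Defensive.

Import Order.TTheory GRing.Theory Num.Theory.
Local Open Scope classical_set_scope.
Local Open Scope ring_scope.

(** The canonical basis of the full algebra restricts to the subalgebra: the
    elements [Bc A] with [A] in [Xiji] form the required basis.

    Let e be the projection of the permutation module onto the sum of the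
    x_l H with l_{r+1} = 0 ([trunc]). The compression f |-> e f e ([corner])
    is a linear projection of the Schur algebra onto [schur_ji]. If
    [A] = kappa (l, g, m), then [A] lies in [Xiji] exactly when
    l_{r+1} = m_{r+1} = 0 ([kappa_Xiji]): the entries of the row r + 1 of [A]
    count the points of the last block of l, which is symmetric about the
    point d + 1 fixed by g, and columns are rows of the matrix of g^-1. So the
    compression fixes the standard basis elements indexed by [Xiji] and kills
    the others ([corner_sbasis]), and by base change there is a projection P
    of [SL] with the same property.

    The order [alg_lt] preserves row and column sums, so the expansion of
    [Bc A] in the standard basis involves indices all inside or all outside
    [Xiji]. Hence P fixes [Bc A] if [A] is in [Xiji] and kills it otherwise
    ([proj_canonical]), while it fixes [schurL_ji] pointwise. Applying P to
    the expansion of an element of [schurL_ji] in the basis [Bc] shows that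
    only indices in [Xiji] occur, and, as no [Bc A] vanishes, that [Bc A] is
    in [schurL_ji] only if [A] is in [Xiji]. Bar-invariance and the triangular
    expansion are inherited. *)

(** * Finitely supported sums *)

Section Sums.
Variable I : choiceType.

Lemma fsbig_cap_supp (R : Type) (idx : R) (op : Monoid.com_law idx)
    (P S : set I) (F : I -> R) :
  (forall i, ~ S i -> F i = idx) ->
  \big[op/idx]_(i \in P) F i = \big[op/idx]_(i \in P `&` S) F i.
Proof.
move=> FS; apply/esym/fsbig_widen => [i [] //|i [Pi nS]] /=.
by apply: FS => Si; apply: nS.
Qed.

Lemma leq_nsum (P : set I) (F : I -> nat) i :
  finite_set [set j | F j != 0%N] -> P i -> (F i <= nsum P F)%N.
Proof.
move=> finF Pi; have [->//|Fi] := eqVneq (F i) 0%N.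
rewrite /nsum (@fsbig_cap_supp _ _ _ _ [set j | F j != 0%N]); last first.
  by move=> j /negP; rewrite negbK => /eqP.
rewrite (fsbigD1 i) ?leq_addr //=; exact: finite_setIr.
Qed.

Lemma nsum_eq0 (P : set I) (F : I -> nat) :
  (forall i, P i -> F i = 0%N) -> nsum P F = 0%N.
Proof. exact: fsbig1. Qed.

Lemma linear_fsbig (R : nzRingType) (U V : lmodType R) (g : {linear U -> V})
    (P : set I) (c : I -> R) (F : I -> U) : finite_set [set i | c i != 0] ->
  g (\sum_(i \in P) c i *: F i) = \sum_(i \in P) c i *: g (F i).
Proof.
move=> finc; have c0 i : ~ [set i | c i != 0] i -> c i = 0.
  by move=> /negP; rewrite negbK => /eqP.
rewrite !(@fsbig_cap_supp _ _ _ P [set i | c i != 0]) => [|i /c0->|i /c0->];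
  rewrite ?scale0r //.
have fin : finite_set (P `&` [set i | c i != 0]) by exact: finite_setIr.
rewrite !fsbig_finite // raddf_sum; apply: eq_bigr => i _.
exact: linearZ.
Qed.

End Sums.

(** * Blocks of a composition *)

(** An odd D-periodic permutation fixes d + 1 = D / 2. *)
Lemma weyl_mid d (g : weyl d) : g (d%:Z + 1) = d%:Z + 1.
Proof.
have [_ gD gN] := weylP g.
have := gD (- (d%:Z + 1)); rewrite gN.
rewrite (_ : - (d%:Z + 1) + Dper d = d%:Z + 1); rewrite /Dper; lia.
Qed.

Lemma weylK d (g : weyl d) : cancel g (g^-1)%g.
Proof. by move=> x; exact: (congr1 (fun h : weyl d => h x) (mulVg g)). Qed.

Lemma weylKV d (g : weyl d) : cancel (g^-1)%g g.
Proof. by move=> x; exact: (congr1 (fun h : weyl d => h x) (mulgV g)). Qed.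

Section Blocks.
Variables r d : nat.
Implicit Types l m : compo r d.
Local Notation n := (nper r).
Local Notation D := (Dper d).
Local Notation mid := (d%:Z + 1).

Lemma nper_neq0 : n != 0.
Proof. by rewrite /nper; lia. Qed.

Lemma psum_last l : psum l r.+1 = d.
Proof.
rewrite /psum -[RHS](eqP (valP l)).
by apply: eq_bigr => i _; rewrite /part /= inord_val.
Qed.

Lemma psumS l k : psum l k.+1 = (psum l k + part l k.+1)%N.
Proof. by rewrite /psum big_ord_recr. Qed.

Lemma psum0 l : psum l 0 = part l 0.
Proof. by rewrite /psum big_ord1. Qed.

Lemma psum_mono l k k' : (k <= k')%N -> (psum l k <= psum l k')%N.
Proof.
elim: k' => [|k' IH]; first by rewrite leqn0 => /eqP->.
by rewrite leq_eqVlt => /predU1P[->//|/IH]; rewrite psumS; lia.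
Qed.

Lemma block_low l k t x : (k <= r.+1)%N ->
  block l (k%:Z + t * n) x <-> block0 l k (x - t * D).
Proof.
move=> kr; have n0 := nper_neq0.
have kn : ((k%:Z + t * n)%R %% n)%Z = k%:Z.
  by rewrite addrC modzMDl modz_small //; rewrite /nper; lia.
have tn : ((k%:Z + t * n)%R %/ n)%Z = t.
  by rewrite addrC divzMDl // divz_small ?addr0 // /nper; lia.
by rewrite /block kn tn absz_nat kr.
Qed.

Lemma block_high l k t x : (0 < k <= r)%N ->
  block l (- k%:Z + t * n) x <-> block0 l k (- (x - t * D)).
Proof.
move=> kr; have n0 := nper_neq0.
have -> : - k%:Z + t * n = (t - 1) * n + (r.*2 + 2 - k)%N%:Z.
  by rewrite mulrBl mul1r /nper; lia.
have kn : (((t - 1) * n + (r.*2 + 2 - k)%N%:Z)%R %% n)%Z = (r.*2 + 2 - k)%N.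
  by rewrite modzMDl modz_small //; rewrite /nper; lia.
have tn : (((t - 1) * n + (r.*2 + 2 - k)%N%:Z)%R %/ n)%Z = t - 1.
  by rewrite divzMDl // divz_small ?addr0 // /nper; lia.
rewrite /block kn tn absz_nat ifF; last by apply/negbTE; lia.
rewrite (_ : (r.*2 + 2 - (r.*2 + 2 - k))%N = k); last lia.
by rewrite /= (_ : x - (t - 1) * D - D = x - t * D) // mulrBl mul1r; lia.
Qed.

(** Every index is, up to a translation, nonnegative or the opposite of a
    positive one; this reduces a question on blocks to [block0]. *)
Lemma blockP l i x : block l i x -> exists k t,
  [/\ (k <= r.+1)%N, i = k%:Z + t * n & block0 l k (x - t * D)] \/
  [/\ (0 < k <= r)%N, i = - k%:Z + t * n & block0 l k (- (x - t * D))].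
Proof.
have n0 := nper_neq0.
have e := divz_eq i n; have lo := modz_ge0 i n0.
have hi : (i %% n)%Z < n by apply: ltz_pmod; rewrite /nper; lia.
move: e lo hi; set t := (i %/ n)%Z; set k := (i %% n)%Z => e lo hi.
have [kr|kr] := leqP `|k|%N r.+1.
  have ik : i = `|k|%N%:Z + t * n by rewrite e; lia.
  by rewrite ik block_low // => bx; exists `|k|%N, t; left.
have kr' : (0 < r.*2 + 2 - `|k|%N <= r)%N by move: hi; rewrite /nper; lia.
have ik : i = - (r.*2 + 2 - `|k|)%N%:Z + (t + 1) * n.
  by rewrite e mulrDl mul1r; move: hi; rewrite /nper; lia.
rewrite ik block_high // => bx.
by exists (r.*2 + 2 - `|k|)%N, (t + 1); right.
Qed.

Lemma block0_bound l k x : (k <= r)%N -> block0 l k x -> - d%:Z <= x <= d%:Z.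
Proof.
move=> kr; rewrite /block0 kr; case: eqP => [_|_] /=.
  by have := ltn_ord (l (inord 0)); rewrite /part; lia.
by have := psum_mono l (leq_trans kr (leqnSn r)); rewrite psum_last; lia.
Qed.

Lemma block0_last l x :
  block0 l r.+1 x =
  (mid - (part l r.+1)%:Z <= x <= mid + (part l r.+1)%:Z) :> Prop.
Proof. by rewrite /block0 /= ltnn. Qed.

Lemma part_le l k : (part l k <= d)%N.
Proof. by rewrite -ltnS ltn_ord. Qed.

Lemma block_r1 l x :
  block l (r1 r) x =
  (mid - (part l r.+1)%:Z <= x <= mid + (part l r.+1)%:Z) :> Prop.
Proof.
rewrite -block0_last; apply/propext.
have := @block_low l r.+1 0 x (leqnn _).
by rewrite !mul0r addr0 subr0.
Qed.

Lemma block0_pos l k x : (0 < k <= r)%N -> block0 l k x -> 1 <= x <= d%:Z.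
Proof.
move=> /andP[k0 kr]; rewrite /block0 gtn_eqF // kr /= => h.
by have := psum_mono l (leq_trans kr (leqnSn r)); rewrite psum_last; lia.
Qed.

Lemma block_mid l i : block l i mid -> i = r1 r.
Proof.
case/blockP=> k [t] [[kr -> bx]|[kr _ /(block0_pos kr)]]; last first.
  by have [t0|t0] := lerP t 0; rewrite /Dper; nia.
have [k_r|k_r] := leqP k r.
  by have := block0_bound k_r bx; have [t0|t0] := lerP t 0; rewrite /Dper; nia.
have kE : k = r.+1 by lia.
move: bx; rewrite kE block0_last /Dper => h.
have pd := part_le l r.+1.
have -> : t = 0 by nia.
by rewrite mul0r addr0.
Qed.

Lemma block0_cover l (y : nat) : (y <= d.+1)%N ->
  exists2 k, (k <= r.+1)%N & block0 l k y%:Z.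
Proof.
rewrite leq_eqVlt => /predU1P[->|yd].
  by exists r.+1; rewrite // block0_last; lia.
have ex : exists k, (y <= psum l k)%N by exists r.+1; rewrite psum_last; lia.
case: (ex_minnP ex) => k yk kmin; exists k.
  by apply: kmin; rewrite psum_last; lia.
rewrite /block0; case: eqP yk kmin => [->|/eqP k0] yk kmin /=.
  by rewrite psum0 in yk; lia.
have yk1 : (psum l k.-1 < y)%N.
  by rewrite ltnNge; apply/negP => /kmin; lia.
case: leqP => kr /=; first by lia.
have := psum_last l; rewrite psumS.
have := psum_mono l (_ : r <= k.-1)%N; lia.
Qed.

Lemma block_cover l x : exists i, block l i x.
Proof.
pose t := ((x + d%:Z)%R %/ D)%Z; pose y := x - t * D.
have yb : - d%:Z <= y <= mid.
  have D0 : D != 0 by rewrite /Dper; lia.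
  have := divz_eq (x + d%:Z) D; have := modz_ge0 (x + d%:Z) D0.
  have : ((x + d%:Z)%R %% D)%Z < D by apply: ltz_pmod; rewrite /Dper; lia.
  by rewrite -/t /y; set u := t * D; rewrite /Dper; lia.
have [y0|y0] := lerP 0 y.
  have [k kr bk] := @block0_cover l `|y|%N ltac:(lia).
  exists (k%:Z + t * n); apply/block_low => //.
  by rewrite -/y (_ : y = `|y|%N%:Z) //; lia.
have [k kr] := @block0_cover l `|y|%N ltac:(lia).
have -> : `|y|%N%:Z = - y by lia.
have [->|k0] := posnP k.
  move=> bk; exists (0%N%:Z + t * n); apply/block_low => //.
  by move: bk; rewrite /block0 /= -/y; lia.
have [kr'|kr'] := leqP k r.
  move=> bk; exists (- k%:Z + t * n).
  by apply/block_high => //; apply/andP; split.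
(* The last block is symmetric about the midpoint [d + 1] of a period. *)
have -> : k = r.+1 by lia.
rewrite block0_last => bk; exists (r.+1%:Z + (t - 1) * n); apply/block_low => //.
rewrite block0_last mulrBl mul1r.
by move: bk; rewrite /y; set u := t * D; rewrite /Dper; lia.
Qed.

Lemma finite_int_itv (a b : int) : finite_set [set x : int | a <= x <= b].
Proof.
apply: (@sub_finite_set _ _ ((fun k : nat => a + k%:Z) @` `I_(`|b - a|%N.+1))).
  move=> x /= h; exists `|x - a|%N; lia.
by apply: finite_image; exact: finite_II.
Qed.

Lemma finite_block0 l k : finite_set (block0 l k).
Proof.
rewrite /block0; case: ifP => _; first exact: finite_int_itv.
by case: ifP => _; exact: finite_int_itv.
Qed.

Lemma finite_block l i : finite_set (block l i).
Proof.
rewrite /block; case: ifP => _; apply: (@finite_preimage _ _ (block0 _ _));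
  try exact: finite_block0; by move=> x y _ _; lia.
Qed.

(** * The matrix of a double coset *)

Lemma finite_kappa l (g : weyl d) m i j :
  finite_set (block l i `&` (g @` block m j)).
Proof. by apply: finite_setIl; exact: finite_block. Qed.

Lemma kappaV l (g : weyl d) m i j : kappa l g m i j = kappa m (g^-1)%g l j i.
Proof.
rewrite /kappa.
have -> : block m j `&` ((g^-1)%g @` block l i) =
          (g^-1)%g @` (block l i `&` (g @` block m j)).
  apply/seteqP; split=> x /=.
    move=> [xm [y yl yx]]; exists y => //; split=> //.
    by exists x => //; rewrite -yx weylKV.
  move=> [y [yl [z zm zy]] yx]; split; last by exists y.
  by rewrite -yx -zy weylK.
apply/fcard_eq; first exact: finite_kappa.
  by apply: finite_image; exact: finite_kappa.
rewrite card_eq_sym; apply: inj_card_eq => x y _ _.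
exact: (can_inj (weylKV g)).
Qed.

Lemma kappa_gt0 l (g : weyl d) m i j x :
  block l i (g x) -> block m j x -> (0 < kappa l g m i j)%N.
Proof.
move=> lgx mx; rewrite /kappa cardfs_gt0; apply/fset0Pn; exists (g x).
by rewrite in_fset_set ?inE //=; [split=> //; exists x | exact: finite_kappa].
Qed.

Lemma XiP (A : Xi r d) : is_Xi r d A.
Proof. by case: A => A /= /asboolP. Qed.

(** The last entry of [rowc] vanishes exactly when the last block of [l] is just the
    fixed point [d + 1] of [g]. The matrix is not required to be in [Xi], so that
    the lemma also applies to transposes, which gives columns. *)
Lemma kappa_row_eq0 (A : int -> int -> nat) l g m : kappa l g m = A ->
  (forall i j, A (- i) (- j) = A i j /\ A i j = A (i + n) (j + n)) ->
  odd (A (r1 r) (r1 r)) -> finite_set [set j | A (r1 r) j != 0%N] ->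
  rowc (r := r) A ord_max = 0%N <-> part l r.+1 = 0%N.
Proof.
move=> kA sym oddA finA.
have rmax : val (@ord_max r.+1) = r.+1 by [].
rewrite /rowc rmax eqxx /=; split=> [/eqP|l0]; last first.
  (* The block reduces to the fixed point [d + 1] of [g]. *)
  have lx x : block l (r1 r) x -> x = mid by rewrite block_r1 l0; lia.
  rewrite nsum_eq0 => [|j /= jr]; last first.
    rewrite -kA; apply/eqP; rewrite -leqn0 leqNgt cardfs_gt0; apply/negP.
    case/fset0Pn=> y; rewrite in_fset_set ?inE /=; last exact: finite_kappa.
    move=> [/lx-> [x mx /(congr1 (g^-1)%g)]]; rewrite weylK weyl_mid => xE.
    by move: mx; rewrite xE => /block_mid jE; move: jr; rewrite jE /r1; lia.
  rewrite addn0 -kA; set c := kappa _ _ _ _ _.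
  suff: (c <= 1)%N by case: c => [|[]].
  rewrite -[1%N](cardfs1 mid); apply: fsubset_leq_card; apply/fsubsetP => y.
  by rewrite in_fset_set ?inE /= => [[/lx->]|]; last exact: finite_kappa.
rewrite addn_eq0 => /andP[/eqP c0 /eqP s0].
have A0 j : (j <= r%:Z)%R -> A (r1 r) j = 0%N.
  move=> jr; apply/eqP; rewrite -leqn0 -s0; exact: leq_nsum.
apply/eqP; rewrite -leqn0 leqNgt; apply/negP => l0.
have dl : block l (r1 r) d%:Z by rewrite block_r1; lia.
have [j] := block_cover m ((g^-1)%g d%:Z).
set x := (g^-1)%g d%:Z => mx.
have gx : g x = d%:Z by rewrite /x weylKV.
have Aj : (0 < A (r1 r) j)%N by rewrite -kA (@kappa_gt0 _ _ _ _ _ x) // gx.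
(* The row is symmetric about its index [r + 1]: the cases [j > r + 1] and
   [j <= r] are equivalent. *)
have [jr|jr|jr] := ltrgtP j (r1 r).
- by move: Aj; rewrite A0 //; move: jr; rewrite /r1; lia.
- have [_ s2] := sym (- r1 r) (- j).
  have [s3 _] := sym (r1 r) j.
  have r1E : - r1 r + nper r = r1 r by rewrite /r1 /nper; lia.
  move: Aj; rewrite -s3 s2 r1E.
  by rewrite A0 // /nper; move: jr; rewrite /r1; lia.
(* If [d] stays in the last block, the diagonal entry counts [d] and [d + 1]. *)
have A2 : (2 <= A (r1 r) (r1 r))%N.
  rewrite -kA -[2%N]/((true : nat).+1).
  have -> : true = (d%:Z != mid :> int) by apply/esym; lia.
  rewrite -cardfs2; apply: fsubset_leq_card; apply/fsubsetP => y.
  rewrite in_fset_set; last exact: finite_kappa.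
  rewrite !inE => /orP[/eqP->|/eqP->] /=.
    by split=> //; exists x => //; rewrite -jr.
  split; first by rewrite block_r1; lia.
  by exists mid; rewrite ?weyl_mid // block_r1; lia.
by move: c0 oddA A2; case: (A _ _) => [|[|[|k]]].
Qed.

Lemma Xi_shift (A : Xi r d) i j t : A (i + t * n) (j + t * n) = A i j.
Proof.
have [sym _ _ _] := XiP A.
have shift k i' j' : A (i' + k%:Z * n) (j' + k%:Z * n) = A i' j'.
  elim: k => [|k IH]; first by rewrite !mul0r !addr0.
  have [_ sh] := sym (i' + k%:Z * n) (j' + k%:Z * n).
  by rewrite -IH sh -addn1 PoszD !mulrDl !mul1r !addrA.
have [t0|t0] := lerP 0 t; first by rewrite -[t]gez0_abs ?shift.
rewrite -[LHS](shift `|t|%N); congr (A _ _); nia.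
Qed.

(** Only the rows are assumed finitely supported; by periodicity, column [j]
    gathers entries of the [r.*2 + 2] rows of a period. *)
Lemma finite_Xi_col (A : Xi r d) j : finite_set [set i | A i j != 0%N].
Proof.
have [_ _ finA _] := XiP A.
apply: (@sub_finite_set _ _ (\bigcup_(k in `I_(r.*2 + 2))
   (fun j' => k%:Z + j - j') @` [set j' | A k%:Z j' != 0%N])).
  move=> i /= Aij; have e := divz_eq i n.
  have lo := modz_ge0 i nper_neq0.
  have hi : (i %% n)%Z < n by apply: ltz_pmod; rewrite /nper; lia.
  move: e lo hi; set t := (i %/ n)%Z; set k := (i %% n)%Z => e lo hi.
  exists `|k|%N; first by move: hi; rewrite /nper /=; lia.
  exists (j - t * n); last by rewrite gez0_abs // e; ring.
  rewrite gez0_abs //= -(Xi_shift A _ _ t).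
  by rewrite [k + _]addrC -e (subrK (t * n) j).
apply: bigcup_finite => [|k _]; first exact: finite_II.
by apply: finite_image; exact: finA.
Qed.

(** The matrix of a double coset belongs to [Xiji] exactly when both of its
    compositions have an empty last part. *)
Lemma kappa_Xiji (A : Xi r d) l g m : kappa l g m = A ->
  Xiji A <-> part l r.+1 = 0%N /\ part m r.+1 = 0%N.
Proof.
move=> kA; have [sym [_ oddA] finA _] := XiP A.
have row0 := kappa_row_eq0 kA sym oddA (finA _).
have kAt : kappa m (g^-1)%g l = (fun i j => A j i).
  by apply/funext => i; apply/funext => j; rewrite -kA [RHS]kappaV.
have col0 := kappa_row_eq0 kAt (fun i j => sym j i) oddA (finite_Xi_col A _).
by split=> [[/row0 ? /col0 ?]|[/row0 ? /col0 ?]].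
Qed.

End Blocks.

(** * The corner of the Schur algebra *)

Section Corner.
Variables (r d : nat) (H : algType AA) (T : 'I_d.+1 -> H).
Local Notation compo := (compo r d).
Local Notation perm_module := (perm_module r T).
Local Notation schur := (schur r T).
Local Notation pgen := (pgen T).
Implicit Types (u v : perm_module) (f g : schur) (l m : compo).

Lemma perm_module_gen u : exists h : compo -> H, u = \sum_l ract (pgen l) (h l).
Proof.
have [h hE] := choice (perm_moduleP u); exists h.
apply: val_inj; apply/ffunP => l /=; rewrite hE.
rewrite (big_morph (fun v => comps v l) (id1 := 0) (op1 := +%R)) => [|v w|];
  rewrite ?ffunE // (bigD1 l) //=.
rewrite !ffunE eqxx big1 ?addr0 // => m ml.
by rewrite !ffunE eq_sym (negPf ml) mul0r.
Qed.

Lemma schurD f u v : f (u + v) = f u + f v.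
Proof. by case: f => f /= /asboolP[]. Qed.

Lemma schur_ract f u h : f (ract u h) = ract (f u) h.
Proof. by case: f => f /= /asboolP[]. Qed.

Lemma schur0 f : f 0 = 0.
Proof. by apply: (addrI (f 0)); rewrite -schurD !addr0. Qed.

Lemma schur_sum f (I : Type) (s : seq I) (F : I -> perm_module) :
  f (\sum_(i <- s) F i) = \sum_(i <- s) f (F i).
Proof. exact: (big_morph f (schurD f) (schur0 f)). Qed.

(** An endomorphism is determined by the images of the generators x_l. *)
Lemma schur_ext f g : (forall l, f (pgen l) = g (pgen l)) -> f = g.
Proof.
move=> fg; apply: val_inj; apply/funext => u /=.
have [h ->] := perm_module_gen u; rewrite !schur_sum.
by apply: eq_bigr => l _; rewrite !schur_ract fg.
Qed.

Lemma trunc_subproof u :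
  [ffun l => if part l r.+1 == 0%N then u l else 0]
    \in in_perm_module (r := r) T.
Proof.
apply/asboolP => l; rewrite ffunE; case: eqP => _; first exact: perm_moduleP.
by exists 0; rewrite mulr0.
Qed.

(** The projection of the permutation module onto the sum of the x_l H with
    l_{r+1} = 0. *)
Definition trunc u : perm_module := PermModule (trunc_subproof u).

Lemma truncE u l : trunc u l = if part l r.+1 == 0%N then u l else 0.
Proof. by rewrite /= ffunE. Qed.

Lemma trunc_linear a u v : trunc (a *: u + v) = a *: trunc u + trunc v.
Proof.
apply: val_inj; apply/ffunP => l; rewrite /= !ffunE.
by case: eqP; rewrite // scaler0 addr0.
Qed.

Lemma truncD u v : trunc (u + v) = trunc u + trunc v.
Proof. by have := trunc_linear 1 u v; rewrite !scale1r. Qed.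

Lemma trunc0 : trunc 0 = 0.
Proof. by apply: (addrI (trunc 0)); rewrite -truncD !addr0. Qed.

Lemma trunc_ract u h : trunc (ract u h) = ract (trunc u) h.
Proof.
apply: val_inj; apply/ffunP => l; rewrite /= !ffunE.
by case: eqP; rewrite // mul0r.
Qed.

Lemma trunc_pgen l : trunc (pgen l) = if part l r.+1 == 0%N then pgen l else 0.
Proof.
apply: val_inj; apply/ffunP => m; rewrite truncE.
have [->|ml] := eqVneq m l; first by case: ifP => _ //=; rewrite ffunE.
by do 2!case: ifP => _; rewrite /= ?ffunE ?(negPf ml).
Qed.

Lemma corner_subproof f :
  (fun u => trunc (f (trunc u))) \in is_endo (r := r) (T := T).
Proof.
apply/asboolP; split=> [u v|u h]; first by rewrite truncD schurD truncD.
by rewrite trunc_ract schur_ract trunc_ract.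
Qed.

(** The compression e f e of f by the idempotent e = [trunc]. *)
Definition corner f : schur := Defs.Schur (corner_subproof f).

Lemma corner_linear a f g : corner (a *: f + g) = a *: corner f + corner g.
Proof. by apply: val_inj; apply/funext => u; exact: trunc_linear. Qed.

(** The subalgebra is the set of fixed points of the compression. *)
Lemma schur_jiP f : schur_ji f <-> corner f = f.
Proof.
split=> [[f0 fV]|<-].
  apply: schur_ext => m /=; rewrite trunc_pgen.
  have -> : f (if part m r.+1 == 0%N then pgen m else 0) = f (pgen m).
    by case: ifPn => // /f0->; rewrite schur0.
  by apply: val_inj; apply/ffunP => l; rewrite truncE; case: ifPn => // /fV->.
split=> [m /negPf m0|u l /negPf l0]; last by rewrite truncE l0.
by rewrite /= trunc_pgen m0 schur0 trunc0.
Qed.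

Lemma corner0 : corner 0 = 0.
Proof. by apply/schur_jiP; split=> // u l _; rewrite ffunE. Qed.

Lemma corner_ebasis (A : Xi r d) :
  corner (ebasis T A) = if `[< Xiji A >] then ebasis T A else 0.
Proof.
rewrite /ebasis; case: xgetP => [f _ [l [g [m [_ kA fE]]]]|_]; last first.
  by rewrite corner0 if_same.
have ji := kappa_Xiji kA.
have fn k : k != m -> f (pgen k) = 0.
  move=> km; apply: val_inj; apply/ffunP => k'.
  by rewrite /= fE (negPf km) !ffunE if_same.
apply: schur_ext => k /=; rewrite trunc_pgen.
case: asboolP => [/ji[l0 m0]|nji].
  have [->|km] := eqVneq k m; last first.
    by rewrite fn //; case: ifP; rewrite ?schur0 ?fn ?trunc0.
  rewrite m0 eqxx; apply: val_inj; apply/ffunP => k'.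
  rewrite truncE; case: ifPn => // nk'; rewrite /= fE ffunE.
  by case: (k' =P l) nk' => // ->; rewrite l0.
have [km|km] := eqVneq k m; last first.
  by case: ifP; rewrite ?schur0 ?fn ?trunc0.
case: ifPn => m0; last by rewrite schur0 trunc0.
apply: val_inj; apply/ffunP => k'; rewrite truncE fE km eqxx !ffunE.
have [->|//] := eqVneq k' l; last by rewrite if_same.
case: ifPn => // l0; case: nji; apply/ji.
by rewrite -km (eqP m0) (eqP l0).
Qed.

Lemma corner_sbasis (A : Xi r d) :
  corner (sbasis T A) = if `[< Xiji A >] then sbasis T A else 0.
Proof.
rewrite /sbasis -[_ *: _ in LHS]addr0 corner_linear corner_ebasis.
by rewrite corner0; case: ifP => _; rewrite ?scaler0 addr0.
Qed.

End Corner.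

(** * Specialization *)

Section Specialized.
Variables (r d : nat) (L : weyl d -> nat) (H : algType AA) (T : 'I_d.+1 -> H).
Variables (SL : lmodType RR) (iota : schur r T -> SL).
Hypothesis iota_bc : base_change (spec L) iota.
Local Notation Xiji := (@Xiji r d).
Local Notation ji := (schurL_ji iota).

(** The compression extends to the base change, by universality. *)
Lemma base_change_corner :
  exists P : {linear SL -> SL}, forall f, P (iota f) = iota (corner f).
Proof.
have [iota_lin univ] := iota_bc.
have lin : Defs.semilinear (spec L) (fun f => iota (corner f)).
  by move=> a f g; rewrite corner_linear iota_lin.
have [g [[glin gE] _]] := univ _ _ lin.
by exists (HB.pack_for {linear SL -> SL} g
  (GRing.isLinear.Build _ _ _ _ g glin)).
Qed.

Lemma spec1 : spec L 1 = 1.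
Proof.
rewrite /spec /push -(@fsbig_widen _ _ _ _ [set 0]) // => [|e [_ /eqP/negPf e0]] /=.
  by rewrite fsbig_set1 /= /monoe_fun eqxx !mul0r !addr0.
by rewrite /monoe_fun e0 mulr0z.
Qed.

Lemma iota0 : iota 0 = 0.
Proof.
have [iota_lin _] := iota_bc; have := iota_lin 1 0 0.
rewrite scaler0 addr0 spec1 scale1r => e.
by apply: (addrI (iota 0)); rewrite -e addr0.
Qed.

Lemma schurL_jiD u v : ji u -> ji v -> ji (u + v).
Proof.
move=> [s [sji ->]] [t [tji ->]]; exists (s ++ t); rewrite big_cat.
by split=> // p; rewrite mem_cat => /orP[/sji|/tji].
Qed.

Lemma schurL_ji_fsbig (I : choiceType) (D : set I) (c : I -> RR) (F : I -> SL) :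
  finite_set [set i | c i != 0] -> (forall i, D i -> ji (F i)) ->
  ji (\sum_(i \in D) c i *: F i).
Proof.
move=> finc jiF; have ji0 : ji 0 by exists [::]; rewrite big_nil.
rewrite (@fsbig_cap_supp _ _ _ _ D [set i | c i != 0]); last first.
  by move=> i /negP; rewrite negbK => /eqP->; rewrite scale0r.
have fin : finite_set (D `&` [set i | c i != 0]) by exact: finite_setIr.
rewrite fsbig_finite // big_seq; elim/big_ind: _ => //.
  exact: schurL_jiD.
move=> i; rewrite in_fset_set // inE => -[/jiF [s [sji ->]] _].
exists [seq (c i * p.1, p.2) | p <- s]; split=> [_ /mapP[p /sji ps ->] //|].
by rewrite big_map scaler_sumr; apply: eq_bigr => p _; rewrite scalerA.
Qed.

Lemma alg_lt_Xiji (A B : Xi r d) : alg_lt B A -> Xiji B <-> Xiji A.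
Proof. by case=> -[rowBA colBA _] _; rewrite /Defs.Xiji /= rowBA colBA. Qed.

Variable b : Xi r d -> SL.
Hypothesis b_can : canonical_basis L iota setT setT b.

Lemma basis_neq0 (A : Xi r d) : b A <> 0.
Proof.
have [[_ bU] _] := b_can => bA0; have [c [_ cU]] := bU 0 I.
have c0 : c = (fun=> 0).
  apply: cU; split=> [||] //; last first.
    by rewrite fsbig1 // => B _; rewrite scale0r.
  by apply: sub_finite_set (finite_set0 _) => B /=; rewrite eqxx.
have c1 : c = (fun B => (B == A)%:R).
  apply: cU; split=> [||] //.
    apply: sub_finite_set (finite_set1 A) => B /=.
    by case: (eqVneq B A) => // _; rewrite eqxx.
  rewrite fsbig1 // => B _; case: (eqVneq B A) => [->|_].
    by rewrite bA0 scaler0.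
  by rewrite scale0r.
have := congr1 (fun h => h A) c1; rewrite /= c0 eqxx => /esym/eqP.
by rewrite oner_eq0.
Qed.

Lemma iota_sbasis_ji (A : Xi r d) : Xiji A -> ji (sbasisL iota A).
Proof.
move=> jiA; exists [:: (1, sbasis T A)]; rewrite big_seq1 scale1r; split=> // p.
rewrite inE => /eqP-> /=; apply/schur_jiP.
by rewrite corner_sbasis; case: asboolP.
Qed.

(** The terms of the expansion of a canonical basis element have their indices
    on the same side of [Xiji] as the leading one. *)
Lemma canonical_expansion (A : Xi r d) : exists c : Xi r d -> RR,
  [/\ finite_set [set B | c B != 0], forall B, vVcZ L (c B)
    & b A = sbasisL iota A +
        \sum_(B \in [set B | (Xiji B <-> Xiji A) /\ alg_lt B A])
          c B *: sbasisL iota B].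
Proof.
have [_ /(_ A I) [_ [c [finc cv bE]]]] := b_can; exists c; split=> //.
rewrite bE; congr (_ + _); apply: eq_fsbigl.
by apply/seteqP; split=> B /= [_ BA]; split=> //; exact: alg_lt_Xiji.
Qed.

Lemma canonical_ji (A : Xi r d) : Xiji A -> ji (b A).
Proof.
move=> jiA; have [c [finc _ ->]] := canonical_expansion A.
apply: schurL_jiD; first exact: iota_sbasis_ji.
by apply: schurL_ji_fsbig => // B [[_ /(_ jiA) jiB] _]; exact: iota_sbasis_ji.
Qed.

Section Projection.
Variable P : {linear SL -> SL}.
Hypothesis PE : forall f, P (iota f) = iota (corner f).

Lemma proj_ji u : ji u -> P u = u.
Proof.
move=> [s [sji ->]]; rewrite raddf_sum big_seq [RHS]big_seq.
apply: eq_bigr => p /sji /schur_jiP pE.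
by rewrite -[in RHS]pE -PE; exact: linearZ.
Qed.

Lemma proj_canonical (A : Xi r d) : P (b A) = if `[< Xiji A >] then b A else 0.
Proof.
case: asboolP => [/canonical_ji/proj_ji//|njiA].
have Psb B : ~ Xiji B -> P (sbasisL iota B) = 0.
  by move=> njiB; rewrite /sbasisL PE corner_sbasis asboolF // iota0.
have [c [finc _ ->]] := canonical_expansion A.
rewrite linearD linear_fsbig // fsbig1 => [|B [[BA _] _]]; last first.
  by rewrite Psb ?scaler0 // => /BA.
by rewrite addr0; exact: Psb.
Qed.

End Projection.

Lemma canonical_jiP (A : Xi r d) : Xiji A <-> ji (b A).
Proof.
split=> [|jibA]; first exact: canonical_ji.
have [P PE] := base_change_corner; have := proj_canonical PE A.
by case: asboolP => // _; rewrite proj_ji // => /basis_neq0.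
Qed.

Lemma canonical_basis_ji : canonical_basis L iota Xiji ji b.
Proof.
have [[_ bU] bcan] := b_can; split; last first.
  move=> A jiA; split; first by have [] := bcan A I.
  have [c [finc cv bE]] := canonical_expansion A; exists c; split=> //.
  rewrite {1}bE; congr (_ + _); apply: eq_fsbigl.
  by apply/seteqP; split=> B /= [] => [[_ /(_ jiA)]|].
split=> [A|u jiu]; first exact: canonical_ji.
have [P PE] := base_change_corner.
have [c [[finc _ uE] cU]] := bU u I.
have sumE (e : Xi r d -> RR) : (forall A, e A != 0 -> Xiji A) ->
    \sum_(A \in Xiji) e A *: b A = \sum_(A \in setT) e A *: b A.
  move=> eji; apply: fsbig_widen => // A [_ njiA] /=.
  by have [->|/eji//] := eqVneq (e A) 0; rewrite scale0r.
(* Projecting the expansion of [u] only removes the terms outside [Xiji]. *)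
have cji A : c A != 0 -> Xiji A.
  pose c' A := if `[< Xiji A >] then c A else 0.
  have -> : c = c'.
    apply: cU; split=> //.
      apply: sub_finite_set finc => B /=; rewrite /c'.
      by case: asboolP => // _; rewrite eqxx.
    rewrite -[LHS](proj_ji PE jiu) uE linear_fsbig //.
    apply: eq_fsbigr => B _; rewrite (proj_canonical PE) /c'.
    by case: asboolP; rewrite ?scaler0 ?scale0r.
  by rewrite /c'; case: asboolP => // _; rewrite eqxx.
exists c; split=> [|e [fine eji eE]].
  by split=> //; rewrite sumE.
by apply: cU; split=> //; rewrite -sumE.
Qed.

End Specialized.

Theorem theorem5p10 (r d : nat) (hd : (1 < d)%N)
  (L : weyl d -> nat) (hL : weight_function L)
  (H : algType AA) (T : 'I_d.+1 -> H) (hH : hecke_algebra T)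
  (SL : lmodType RR) (iota : schur r T -> SL)
  (hS : base_change (spec L) iota)
  (Bc : Xi r d -> SL) (hBc : canonical_basis L iota setT setT Bc) :
  exists Bji : Xi r d -> SL,
    canonical_basis L iota (@Xiji r d) (schurL_ji iota) Bji /\
    [set Bji A | A in @Xiji r d] = [set Bc A | A in setT] `&` schurL_ji iota.
Proof.
exists Bc; split; first exact: canonical_basis_ji.
apply/seteqP; split=> [_ [A jiA <-]|u [[A _ <-]]].
  by split; [exists A | exact: (canonical_ji hBc jiA)].
by move=> /(canonical_jiP hS hBc) jiA; exists A.
Qed.
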